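(* Let $0<\lambda<1$ and $\delta,\epsilon>0$. Then, for all sufficiently large $n$, for any $G_1\in\mathcal{G}_n(\lambda)$ there exists a graph $G'$ on vertex set $[n]$ with unique $3$-neighborhoods such that $$(1-\epsilon)\frac{\log^{2+\delta}(n)}{n}\binom{n}{2}\le d_H(G_1,G')\le (1+\epsilon)\frac{\log^{2+\delta}(n)}{n}\binom{n}{2}.$$
   Context: All graphs are simple graphs on vertex set $[n]=\{1,\dots,n\}$. The $r$-neighborhood $\mathcal{N}_r(v;G)$ of a vertex $v$ in $G$ is the subgraph of $G$ induced on all vertices at graph distance at most $r$ from $v$, with the central vertex $v$ identified; $|\mathcal{N}_r(v;G)|$ is its number of vertices. A graph has unique $3$-neighborhoods if for every pair of distinct vertices $u,v$ there is no graph isomorphism from the $3$-neighborhood of $u$ to the $3$-neighborhood of $v$ mapping $u$ to $v$. $\mathcal{G}_n(\lambda) := \{G=([n],E) : |\mathcal{N}_2(v;G)|\le n^{\lambda}\ \text{for all } v\in[n]\}$. $d_H(G,G')$ is the edge Hamming distance: the number of unordered pairs of vertices that are an edge in exactly one of $G$ and $G'$. *)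

(* Defs.v *)
From HB Require Import structures.
From mathcomp Require Import all_boot all_order all_algebra.
From mathcomp Require Import reals exp.

Set Implicit Arguments.
Unset Strict Implicit.
Unset Printing Implicit Defensive.

Record sgraph (V : finType) := SGraph {
  adj :> rel V;
  adj_sym : symmetric adj;
  adj_irr : irreflexive adj
}.

Record rooted_graph := RootedGraph {
  rg_vertex : finType;
  rg_graph : sgraph rg_vertex;
  rg_root : rg_vertex
}.

Definition rooted_iso (H K : rooted_graph) : Prop :=
  exists f : rg_vertex H -> rg_vertex K,
    [/\ bijective f,
        forall x y, rg_graph K (f x) (f y) = rg_graph H x y
      & f (rg_root H) = rg_root K].

Section Neighborhoods.
Variables (V : finType) (G : sgraph V).

Definition induced_rel (S : {set V}) : rel {x : V | x \in S} :=
  fun x y => G (val x) (val y).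

Lemma induced_sym S : symmetric (@induced_rel S).
Proof. by move=> x y; apply: adj_sym. Qed.

Lemma induced_irr S : irreflexive (@induced_rel S).
Proof. by move=> x; apply: adj_irr. Qed.

Definition induced (S : {set V}) : sgraph {x : V | x \in S} :=
  SGraph (@induced_sym S) (@induced_irr S).

Definition has_walk (u v : V) (k : nat) : bool :=
  [exists p : k.-tuple V, path G u p && (last u p == v)].

(* The least length of a walk from u to v. A shortest path has fewer than #|V|
   edges, so the search range suffices when u and v are connected; otherwise
   the value is the irrelevant default #|V|. *)
Definition gdist (u v : V) : nat := find (has_walk u v) (iota 0 #|V|).

(* Vertices at distance at most r from v; those in other connected components
   are at infinite distance, whatever r. *)
Definition gball (r : nat) (v : V) : {set V} :=
  [set u | connect G v u && (gdist v u <= r)].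

Lemma gballP r v u :
  reflect (exists p : seq V, [/\ path G v p, last v p = u & size p <= r])
          (u \in gball r v).
Proof.
apply: (iffP idP) => [|[p [Gp lp sp]]].
  rewrite inE => /andP[/connectP[p Gp ->]].
  case/shortenP: Gp => q Gq Uq _ le_r.
  have sq : size q < #|V| by rewrite -[X in X <= _]/(size (v :: q)) -(card_uniqP Uq) max_card.
  have hasw : has (has_walk v (last v q)) (iota 0 #|V|).
    apply/hasP; exists (size q); first by rewrite mem_iota add0n.
    by apply/existsP; exists (in_tuple q); rewrite /= Gq eqxx.
  have := nth_find 0 hasw; rewrite -/(gdist v (last v q)).
  rewrite nth_iota; last by rewrite /gdist -{2}(size_iota 0 #|V|) -has_find.
  rewrite add0n => /existsP[t /andP[Gt /eqP lt]].
  by exists t; rewrite size_tuple.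
rewrite inE; apply/andP; split; first by apply/connectP; exists p.
move: lp; case/shortenP: Gp => q Gq Uq sub_qp lq.
have sq : size q < #|V| by rewrite -[X in X <= _]/(size (v :: q)) -(card_uniqP Uq) max_card.
have le_qp : size q <= size p by apply: uniq_leq_size => //; case/andP: Uq.
apply: leq_trans (leq_trans le_qp sp); rewrite leqNgt; apply/negP => lt_q.
have := before_find 0 lt_q; rewrite nth_iota // add0n => /existsP[].
by exists (in_tuple q); rewrite /= Gq lq eqxx.
Qed.

Lemma gball_center r v : v \in gball r v.
Proof. by apply/gballP; exists [::]. Qed.

Definition nbhd (r : nat) (v : V) : rooted_graph :=
  RootedGraph (induced (gball r v))
              (exist (fun x => x \in gball r v) v (gball_center r v)).

Definition unique_nbhds (r : nat) : Prop :=
  forall u v : V, u != v -> ~ rooted_iso (nbhd r u) (nbhd r v).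

End Neighborhoods.

(* The vertex set [n] is rendered as 'I_n. *)
Definition small_two_nbhds (R : realType) (n : nat) (lambda : R)
    (G : sgraph 'I_n) : Prop :=
  forall v : 'I_n, (#|rg_vertex (nbhd G 2 v)|%:R <= powR n%:R lambda)%R.

(* An unordered pair of distinct vertices is represented by its increasing
   ordering. *)
Definition edge_hamming (n : nat) (G G' : sgraph 'I_n) : nat :=
  #|[set p : 'I_n * 'I_n | (p.1 < p.2) && (G p.1 p.2 != G' p.1 p.2)]|.

(* Main.v *)
Require Import Defs.
From mathcomp Require Import all_boot all_order all_algebra.
From mathcomp Require Import reals sequences exp.
From mathcomp Require Import ring lra zify.
Import Order.TTheory GRing.Theory Num.Theory.
Local Open Scope ring_scope.

Set Implicit Arguments.
Unset Strict Implicit.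
Unset Printing Implicit Defensive.

(** The graph [G'] is explicit. Take [b] with [n <= 2 ^ b], [b = O(log n)], and
    rewire only the pairs meeting the first [b + 3] vertices so that [G']
    becomes rigid with a universal vertex. Then every 3-neighborhood is the
    whole graph, and an isomorphism of rooted 3-neighborhoods is an
    automorphism, hence trivial: it fixes three vertices that are recognized by
    their number of non-neighbors, then a path starting at one of them, then
    every other vertex, whose adjacency to the path spells its number in binary.
    This costs at most [(b + 3) n] edge changes,
    far below [n log^(2+delta) n / 2], and the remaining changes are spent on
    pairs of a complete bipartite graph with sides of size [n / 4] among the
    other vertices: rigidity only requires these vertices to keep more than
    [b + 2] non-neighbors. So the distance can be made equal to any prescribed
    integer, here the integer part of the target. *)

Local Open Scope nat_scope.

Lemma eq_from_bits b x y : x < 2 ^ b -> y < 2 ^ b ->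
  (forall j, j < b -> odd (x %/ 2 ^ j) = odd (y %/ 2 ^ j)) -> x = y.
Proof.
elim: b x y => [|b IHb] x y; first by rewrite expn0; lia.
rewrite expnS => xb yb bits.
have eq_odd : odd x = odd y by have := bits 0 isT; rewrite expn0 !divn1.
suff half_eq : x./2 = y./2 by rewrite -(odd_double_half x) eq_odd half_eq odd_double_half.
apply: IHb; [lia | lia |] => j jb.
by have := bits j.+1 jb; rewrite expnS !divnMA !divn2.
Qed.

(** * Automorphisms and universal vertices *)

Section Automorphisms.
Variables (V : finType) (G : sgraph V).

Definition nonneighbors (v : V) : {set V} := [set w | ~~ G v w].

Lemma card_nonneighbors_aut (f : V -> V) v :
  injective f -> (forall x y, G (f x) (f y) = G x y) ->
  #|nonneighbors (f v)| = #|nonneighbors v|.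
Proof.
move=> f_inj fG; have [g fK gK] := injF_bij f_inj.
rewrite -[RHS](card_imset _ f_inj); congr #|pred_of_set _|; apply/setP=> w.
by rewrite -[w]gK mem_imset // !inE fG.
Qed.

Lemma gball_universal z r v : (forall w, w != z -> G z w) -> gball G r.+2 v = setT.
Proof.
move=> Gz; apply/setP=> w; rewrite in_setT; apply/gballP.
have [-> | vz] := eqVneq v z; first have [-> | wz] := eqVneq w z.
- by exists [::].
- by exists [:: w]; rewrite /= Gz.
have [-> | wz] := eqVneq w z.
  by exists [:: z]; rewrite /= adj_sym Gz.
by exists [:: z; w]; rewrite /= adj_sym !Gz.
Qed.

(** Any two vertices are linked through [z] in at most two steps, so both balls are all of [V]. *)
Lemma aut_of_nbhd_iso z r u v : (forall w, w != z -> G z w) ->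
  rooted_iso (nbhd G r.+2 u) (nbhd G r.+2 v) ->
  exists f : V -> V,
    [/\ injective f, forall x y, G (f x) (f y) = G x y & f u = v].
Proof.
move=> Gz [g [g_bij gG gu]].
have inT t x : x \in gball G r.+2 t by rewrite (gball_universal _ _ Gz) in_setT.
exists (fun x => val (g (exist _ x (inT u x)))); split=> [x y | x y | ].
- by move/val_inj/(bij_inj g_bij)/(congr1 val).
- exact: gG (exist _ x (inT u x)) (exist _ y (inT u y)).
have -> : exist _ u (inT u u) = rg_root (nbhd G r.+2 u) by apply: val_inj.
by rewrite gu.
Qed.

End Automorphisms.

(* Adjacency of vertices [i < j] with [i < b + 3]: 0 is universal; 1 is joined to
   0 and to all [v >= b + 3]; the vertices from 2 to [b + 2] form a path; 2 is
   also joined to all [v >= b + 3], and [i >= 3] to those [v] for which bit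
   [i - 3] of [v - (b + 3)] is 1. *)
Definition hub_adj (b i j : nat) : bool :=
  if j < b + 3 then (i == 0) || (1 < i) && (j == i.+1)
  else (i < 3) || odd ((j - (b + 3)) %/ 2 ^ (i - 3)).

Lemma card_ord_lt n k : k <= n -> #|[set i : 'I_n | i < k]| = k.
Proof.
move=> kn.
have widen_inj : injective (widen_ord kn) by move=> i j /(congr1 val) /= /val_inj.
rewrite -[RHS]card_ord -[RHS](card_imset _ widen_inj).
apply: eq_card => i; rewrite inE; apply/idP/imsetP => [ik | [j _ ->]]; last exact: (ltn_ord j).
by exists (Ordinal ik) => //; apply: val_inj.
Qed.

(** * Rigidity of the hub construction *)

Section Rigidity.
Variables (n b : nat) (G : sgraph 'I_n).
Hypotheses (nb : b + 8 <= n) (n2b : n <= 2 ^ b).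
Hypothesis hubG : forall i j : 'I_n, i < j -> i < b + 3 -> G i j = hub_adj b i j.
Hypothesis sparseG : forall i : 'I_n, b + 3 <= i -> b + 3 <= #|nonneighbors G i|.

Let vtx (i : nat) (ib : i < b + 8) : 'I_n := Ordinal (leq_trans ib nb).

Lemma hub_hubE (i j : 'I_n) : i < b + 3 -> j < b + 3 ->
  G i j = (i != j :> nat) && [|| i == 0 :> nat, j == 0 :> nat
    | [&& 1 < i, 1 < j & (j == i.+1 :> nat) || (i == j.+1 :> nat)]].
Proof.
move=> ib jb; case: (ltngtP i j) => ij.
- by rewrite hubG // /hub_adj jb; lia.
- by rewrite adj_sym hubG // /hub_adj ib; lia.
- by rewrite (val_inj ij) adj_irr.
Qed.

Lemma hub_restE (i j : 'I_n) : i < b + 3 -> b + 3 <= j ->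
  G i j = (i < 3) || odd ((j - (b + 3)) %/ 2 ^ (i - 3)).
Proof.
by move=> ib bj; rewrite hubG ?(leq_trans ib bj) // /hub_adj ltnNge bj.
Qed.

Lemma b_gt2 : 2 < b.
Proof.
case: b nb n2b => [|[|[|?]]] //=; rewrite ?expn0 ?expn1 ?expnS ?expn0; lia.
Qed.

(* Vertices 0, 1 and 2 have only 1, [b + 2] and [b + 1] non-neighbors (themselves
   included), so every automorphism fixes them. *)
Lemma hub_codegree (i : 'I_n) : 2 < i -> b + 3 <= #|nonneighbors G i|.
Proof.
move=> i2; case: (ltnP i (b + 3)) => ib; last exact: sparseG.
(* Every bit is 0 in at least three of the numbers 0, 1, 2, 4. *)
have [w1 [w2 [w3 [/and5P[lt12 lt23 lt1 lt2 lt3] [o1 o2 o3]]]]] : exists w1 w2 w3,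
    [&& w1 < w2, w2 < w3, w1 < 5, w2 < 5 & w3 < 5] /\
    [/\ odd (w1 %/ 2 ^ (i - 3)) = false, odd (w2 %/ 2 ^ (i - 3)) = false
       & odd (w3 %/ 2 ^ (i - 3)) = false].
  case: (i - 3) => [|[|t]].
  - by exists 0, 2, 4.
  - by exists 0, 1, 4.
  - exists 0, 1, 2; split=> //; rewrite !expnS.
    by have := expn_gt0 2 t; split; rewrite divn_small //; lia.
have wP w : w < 5 -> w + (b + 3) < b + 8 by lia.
pose W := [set vtx (wP _ lt1); vtx (wP _ lt2); vtx (wP _ lt3)].
pose H := [set j : 'I_n | j < b + 3].
have zP : 0 < b + 8 by lia.
have pP : i.-1 < b + 8 by lia.
have sP : i.+1 < b + 8 by lia.
(* In [H], vertex [i] can only be adjacent to 0, [i - 1] and [i + 1]: at least [b] non-neighbors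
   remain there, besides the three in [W]. *)
pose X := [set vtx zP; vtx pP; vtx sP].
have cW : #|W| = 3 by rewrite /W setUC cardsU1 cards2 !inE /= -!val_eqE /=;
  move: lt12 lt23; clear; lia.
have cX : #|X| <= 3 by rewrite /X setUC cardsU1 cards2; case: (_ \notin _); case: (_ != _).
have cH : #|H| = b + 3 by rewrite /H card_ord_lt; lia.
have geW j : j \in W -> b + 3 <= j.
  by rewrite !inE -orbA => /or3P[] /eqP -> /=; rewrite leq_addl.
have dWH : W :&: (H :\: X) = set0.
  by apply/setP => j; rewrite in_setI;
    case: (boolP (j \in W)) => [/geW bj | _]; rewrite !inE // ltnNge bj andbF.
have sub : W :|: (H :\: X) \subset nonneighbors G i.
  apply/subsetP => j; rewrite in_setU => /orP[jW|].
    rewrite inE hub_restE ?geW // ltnNge i2 /=; move: jW.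
    by rewrite !inE -orbA => /or3P[] /eqP -> /=; rewrite addnK ?o1 ?o2 ?o3.
  rewrite !inE -!val_eqE /= => /andP[jX jb].
  rewrite hub_hubE //; move: jX i2; clear; lia.
apply: leq_trans (subset_leq_card sub); rewrite cardsU dWH cards0 cW.
have := cardsID X H; have := subset_leq_card (subsetIr H X).
by move: cX cH; clear; lia.
Qed.

Ltac hub_set := rewrite !inE -?val_eqE /=;
  match goal with |- context [adj _ _ ?j] =>
    let jb := fresh "jb" in
    case: (ltnP j (b + 3)); move=> jb;
    [rewrite hub_hubE /= | rewrite hub_restE /=]; clear - jb; lia
  end.

Lemma hub_rigid (f : 'I_n -> 'I_n) :
  injective f -> (forall x y, G (f x) (f y) = G x y) -> forall x, f x = x.
Proof.
move=> f_inj fG.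
have cardf v := card_nonneighbors_aut v f_inj fG.
have b2 := b_gt2.
have P0 : 0 < b + 8 by lia.
have P1 : 1 < b + 8 by lia.
have P2 : 2 < b + 8 by lia.
have P3 : 3 < b + 8 by lia.
pose H := [set j : 'I_n | j < b + 3].
have cH : #|H| = b + 3 by rewrite /H card_ord_lt; lia.
have c0 : #|nonneighbors G (vtx P0)| = 1.
  rewrite -[RHS](cards1 (vtx P0)); congr #|pred_of_set _|; apply/setP=> j; hub_set.
have cH0 : #|H :\ vtx P0| = b + 2.
  by have := cardsD1 (vtx P0) H; rewrite cH inE /=; clear; lia.
have cH3 : #|H :\ vtx P0 :\ vtx P3| = b + 1.
  have := cardsD1 (vtx P3) (H :\ vtx P0); rewrite cH0 !inE -val_eqE /=.
  by move: b2; clear; lia.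
have c1 : #|nonneighbors G (vtx P1)| = b + 2.
  by rewrite -cH0; congr #|pred_of_set _|; apply/setP=> j; hub_set.
have c2 : #|nonneighbors G (vtx P2)| = b + 1.
  by rewrite -cH3; congr #|pred_of_set _|; apply/setP=> j; hub_set.
have small (i : 'I_n) : i < 3 -> [\/ i = vtx P0, i = vtx P1 | i = vtx P2].
  case: i => [[|[|[|?]]] ?] //= _; [apply: Or31 | apply: Or32 | apply: Or33]; exact: val_inj.
(* [hub_codegree] forces [f i < 3], where the three counts are distinct. *)
have fix_small (i : 'I_n) : i < 3 -> f i = i.
  move=> i3; have := cardf i.
  case: (ltnP 2 (f i)) => [/hub_codegree fi|fi3].
    move: fi; rewrite cardf => + _; case: (small i i3) => ->; rewrite ?c0 ?c1 ?c2;
      by clear; lia.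
  by case: (small _ fi3) => ->; case: (small i i3) => ->; rewrite ?c0 ?c1 ?c2 //;
    move: b2; clear; lia.
have f0 := fix_small (vtx P0) isT.
have f1 := fix_small (vtx P1) isT.
have ne_f (i j : 'I_n) : f i = i -> j != i :> nat -> f j != i :> nat.
  move=> fi; apply: contra_neq => e.
  have : f j = f i by rewrite fi; apply: val_inj.
  by move/f_inj ->.
(* Among the vertices other than 0 and 1, those below [b + 3] are the non-neighbors of 1. *)
have fhub (i : 'I_n) : i < b + 3 -> 1 < i -> f i < b + 3.
  move=> ib i1; rewrite ltnNge; apply/negP => fib.
  have lt1 : vtx P1 < b + 3 by rewrite /=; lia.
  have := fG (vtx P1) i; rewrite f1 (hub_hubE lt1 ib) (hub_restE lt1 fib) /=.
  by move: i1; clear; lia.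
(* Induction along the path: [f i] is a hub neighbor of the fixed vertex [i - 1], other than 0 and
   [i - 2], which leaves only [i]. *)
have fix_hub k : forall i : 'I_n, i <= k -> i < b + 3 -> f i = i.
  elim: k => [|k IHk] i ik ib; first by apply: fix_small; lia.
  case: (leqP i k) => [|ki]; first by move/IHk; apply.
  case: (ltnP i 3) => i3; first exact: fix_small.
  have pP : i.-1 < b + 8 by lia.
  have ppP : i.-1.-1 < b + 8 by lia.
  have fp : f (vtx pP) = vtx pP by apply: IHk => /=; lia.
  have fpp : f (vtx ppP) = vtx ppP by apply: IHk => /=; lia.
  have fib : f i < b + 3 by apply: fhub => //; lia.
  have fi0 : f i != 0 :> nat by apply: (ne_f _ _ f0) => /=; lia.
  have fipp : f i != i.-1.-1 :> nat by apply: (ne_f _ _ fpp) => /=; lia.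
  have := fG (vtx pP) i; rewrite fp !hub_hubE //=; try lia.
  by move=> E; apply: val_inj => /=; move: fi0 fipp E i3; clear; lia.
move=> i; case: (ltnP i (b + 3)) => ib; first exact: (fix_hub i).
(* If [f i] were in the hub, it would be fixed, and injectivity would give [f i = i]. *)
case: (ltnP (f i) (b + 3)) => fib; first by apply: f_inj; apply: (fix_hub (f i)).
have lt2b (j : 'I_n) : j - (b + 3) < 2 ^ b.
  exact: leq_ltn_trans (leq_subr _ _) (leq_trans (ltn_ord j) n2b).
(* The fixed vertex [j + 3] reads off bit [j] of both offsets. *)
apply: val_inj; rewrite /= -(subnK ib) -(subnK fib); congr (_ + _).
apply: (eq_from_bits (lt2b _) (lt2b _)) => j jb.
have hP : j + 3 < b + 8 by lia.
have fh : f (vtx hP) = vtx hP by apply: (fix_hub (j + 3)) => //=; lia.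
have hb : vtx hP < b + 3 by rewrite /=; move: jb; clear; lia.
have := fG (vtx hP) i; rewrite fh (hub_restE hb ib) (hub_restE hb fib) /=.
by rewrite addnK ltnNge leq_addl.
Qed.

End Rigidity.

(** * Perturbation to an exact distance *)

Lemma card_ord_itv n lo d : lo + d <= n ->
  #|[set i : 'I_n | lo <= i < lo + d]| = d.
Proof.
move=> le_n.
have := cardsID [set i : 'I_n | i < lo] [set i : 'I_n | i < lo + d].
rewrite card_ord_lt //.
have -> : [set i : 'I_n | i < lo + d] :&: [set i : 'I_n | i < lo] = [set i : 'I_n | i < lo].
  by apply/setP=> i; rewrite !inE; lia.
have -> : [set i : 'I_n | i < lo + d] :\: [set i : 'I_n | i < lo]
           = [set i : 'I_n | lo <= i < lo + d].
  by apply/setP=> i; rewrite !inE; lia.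
rewrite card_ord_lt; lia.
Qed.

Lemma subset_of_card (T : finType) (A : {set T}) k : k <= #|A| ->
  exists2 B : {set T}, B \subset A & #|B| = k.
Proof.
move=> kA; exists [set:: take k (enum A)].
  by apply/subsetP=> x; rewrite inE => /mem_take; rewrite mem_enum.
rewrite cardsE (card_uniqP _) ?take_uniq ?enum_uniq // size_takel //.
by rewrite -cardE.
Qed.

Section Planting.
Variables (n b : nat) (G : sgraph 'I_n) (E : {set 'I_n * 'I_n}).

(** [hub_adj] expects its endpoints in increasing order, and [E] may hold a pair in either order. *)
Definition planted_rel : rel 'I_n := fun u v =>
  if u == v then false
  else if minn u v < b + 3 then hub_adj b (minn u v) (maxn u v)
  else G u v (+) (((u, v) \in E) || ((v, u) \in E)).

Lemma planted_sym : symmetric planted_rel.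
Proof.
by move=> u v; rewrite /planted_rel eq_sym minnC maxnC adj_sym orbC.
Qed.

Lemma planted_irr : irreflexive planted_rel.
Proof. by move=> u; rewrite /planted_rel eqxx. Qed.

Definition planted : sgraph 'I_n := SGraph planted_sym planted_irr.

Lemma planted_hub (i j : 'I_n) : i < j -> i < b + 3 -> planted i j = hub_adj b i j.
Proof.
move=> ij ib; rewrite /= /planted_rel -val_eqE /= (ltn_eqF ij).
by rewrite (minn_idPl (ltnW ij)) (maxn_idPr (ltnW ij)) ib.
Qed.

Lemma planted_rest (i j : 'I_n) : i != j -> b + 3 <= i -> b + 3 <= j ->
  planted i j = G i j (+) (((i, j) \in E) || ((j, i) \in E)).
Proof.
by move=> ij bi bj; rewrite /= /planted_rel (negbTE ij) ltnNge leq_min bi bj.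
Qed.

End Planting.

Lemma unique_nbhds_of_perturbation n b a T (G : sgraph 'I_n) :
  b + 8 <= n -> n <= 2 ^ b -> (b + 3) * n <= T -> T <= a * a ->
  (forall v, #|[set w | G v w]| + 2 * (b + 3) + 2 * a <= n) ->
  exists2 G' : sgraph 'I_n, unique_nbhds G' 3 & edge_hamming G G' = T.
Proof.
move=> nb n2b leT Ta degG; set K := b + 3.
have n0 : 0 < n by lia.
have Kan : K + a + a <= n by have := degG (Ordinal n0); rewrite /K; lia.
pose A := [set i : 'I_n | K <= i < K + a].
pose B := [set i : 'I_n | K + a <= i < K + a + a].
(* [D] collects the changes forced by the hub; the other [T - #|D|] are taken in [A] times [B],
   where pairs are increasing because [A] precedes [B]. *)
pose D := [set p : 'I_n * 'I_n | [&& p.1 < p.2, p.1 < K & G p.1 p.2 != hub_adj b p.1 p.2]].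
have cD : #|D| <= T.
  apply: leq_trans _ leT.
  apply: (@leq_trans #|setX [set i : 'I_n | i < K] [set: 'I_n]|).
    by apply/subset_leq_card/subsetP=> -[i j]; rewrite !inE => /and3P[_ /= -> _].
  by rewrite cardsX cardsT card_ord card_ord_lt //; lia.
have cAB : #|setX A B| = a * a.
  by rewrite cardsX /A /B !card_ord_itv //; lia.
have [E sE cE] : exists2 E : {set 'I_n * 'I_n}, E \subset setX A B & #|E| = T - #|D|.
  by apply: subset_of_card; rewrite cAB (leq_trans (leq_subr _ _)).
have bipE i j : (i, j) \in E -> [/\ K <= i, i < j, i < K + a + a & j < K + a + a].
  move/(subsetP sE); rewrite !inE /= => /andP[/andP[? ?] /andP[? ?]].
  by split=> //; lia.
move: (planted b G E) (@planted_hub n b G E) (@planted_rest n b G E) => G' hubP restP.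
have sparse (v : 'I_n) : K <= v -> K <= #|nonneighbors G' v|.
  move=> Kv; pose I := [set i : 'I_n | i < K + a + a].
  (* Beyond the hub, [A] and [B], adjacency to [v] is unchanged, so the degree of [v] grows by at
     most [K + 2 * a]. *)
  have sub : [set w | G' v w] \subset I :|: [set w | G v w].
    apply/subsetP=> w; rewrite !inE; case: (ltnP w (K + a + a)) => [//|wI] /=.
    have [-> | vw] := eqVneq v w; first by rewrite !adj_irr.
    rewrite restP //; last by move: wI; rewrite /K; clear; lia.
    suff -> : ((v, w) \in E) || ((w, v) \in E) = false by rewrite addbF.
    by apply/negP => /orP[] /bipE[_ _]; lia.
  have -> : nonneighbors G' v = ~: [set w | G' v w] by apply/setP=> w; rewrite !inE.
  rewrite cardsCs setCK card_ord; have := leq_trans (subset_leq_card sub) (leq_card_setU _ _).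
  by rewrite card_ord_lt //; have := degG v; rewrite /K; lia.
have rigid := hub_rigid nb n2b hubP sparse.
pose z := Ordinal n0.
have Gz w : w != z -> G' z w.
  rewrite -val_eqE /= => w0; rewrite hubP /= ?lt0n //; last by rewrite addnS.
  by rewrite /hub_adj if_same.
exists G'; first move=> u v /negP uv /(aut_of_nbhd_iso Gz)[f [f_inj fG fu]].
  by apply: uv; rewrite -fu rigid.
have -> : edge_hamming G G' = #|D :|: E|.
  rewrite /edge_hamming; congr #|pred_of_set _|; apply/setP=> -[i j].
  rewrite in_setU !inE /=; case: (ltnP i j) => ij /=; last first.
    by apply/esym/negP => /bipE[_]; rewrite ltnNge ij.
  case: (ltnP i K) => iK /=.
    rewrite hubP //; case: (boolP (_ \in E)) => [/bipE[]|]; last by rewrite orbF.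
    by rewrite leqNgt iK.
  rewrite restP //; [| by rewrite -val_eqE /= ltn_eqF | exact: leq_trans (ltnW ij)].
  have -> : (j, i) \in E = false by apply/negP => /bipE[_]; rewrite ltnNge ltnW.
  by case: (G i j); case: (_ \in E).
rewrite cardsU; have -> : D :&: E = set0.
  apply/setP=> -[i j]; rewrite in_setI !inE /=; apply/negP => /andP[/and3P[_ iK _] /bipE[]].
  by rewrite leqNgt iK.
by rewrite cards0 subn0 cE subnKC.
Qed.

Local Open Scope ring_scope.

(** * Growth estimates *)

Section Growth.
Variable R : realType.
Implicit Types (x s C lambda : R).

Lemma powR_le_expR_div s C x : 0 < s -> 0 < C -> 0 < x ->
  2 * (s * ln (2 * s) + ln C) <= x -> powR x s <= expR x / C.
Proof.
move=> s0 C0 x0 le_x.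
rewrite -[leLHS]lnK ?posrE ?powR_gt0 // -[C]lnK // -expRB ler_expR ln_powR.
have ss0 : 0 < 2 * s by lra.
have xs0 : 0 < x / (2 * s) by rewrite divr_gt0.
have xE : x = x / (2 * s) * (2 * s) by rewrite divfK ?gt_eqF.
(* With [ln y < y] at [y = x / (2 * s)], the first term costs at most [x / 2] after multiplication
   by [s]; the hypothesis pays for the rest. *)
have lnE : ln x = ln (x / (2 * s)) + ln (2 * s) by rewrite -lnM ?posrE // -xE.
have lt_ln := ln_sublinear xs0.
have : s * ln (x / (2 * s)) <= s * (x / (2 * s)) by rewrite ler_pM2l // ltW.
have -> : s * (x / (2 * s)) = x / 2 by field; rewrite gt_eqF.
by rewrite lnE mulrDr; lra.
Qed.

Lemma powR_le_div lambda C x : 0 < x -> 0 < C -> ln C <= (1 - lambda) * ln x ->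
  powR x lambda <= x / C.
Proof.
move=> x0 C0 le_ln; rewrite -ler_ln ?posrE ?powR_gt0 ?divr_gt0 //.
by rewrite ln_powR ln_div ?posrE //; lra.
Qed.

Lemma up_log2_le_ln n : (1 < n)%N ->
  (up_log 2 n)%:R <= (ln 2)^-1 * ln n%:R + 1 :> R.
Proof.
move=> n1; have /andP[lt_n _] := up_log_bounds (isT : 1 < 2)%N n1.
have ln2 : 0 < ln 2 :> R by rewrite ln_gt0 // ltr1n.
have b0 : (0 < up_log 2 n)%N by rewrite up_log_gt0.
rewrite -(prednK b0) -natr1 lerD2r ler_pdivlMl // mulr_natr -lnXn ?ltr0n //.
by rewrite ler_ln ?posrE ?exprn_gt0 ?ltr0n ?(ltnW n1) // -natrX ler_nat ltnW.
Qed.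

Lemma natr_bin2 n : 2 * 'C(n, 2)%:R = n%:R * (n%:R - 1) :> R.
Proof.
case: n => [|n]; first by rewrite bin0n mulr0 mul0r.
rewrite -[n.+1%:R]natr1 addrK natr1 -!natrM bin2 mul2n halfK.
by rewrite oddM oddS andNb subn0.
Qed.

End Growth.

(** * Choice of the parameters for large [n] *)

Theorem corollary1 (R : realType) (lambda delta epsilon : R)
    (lambda_gt0 : 0 < lambda) (lambda_lt1 : lambda < 1)
    (delta_gt0 : 0 < delta) (epsilon_gt0 : 0 < epsilon) :
  exists N : nat, forall n : nat, (N <= n)%N ->
  forall G1 : sgraph 'I_n, small_two_nbhds lambda G1 ->
  exists G' : sgraph 'I_n,
    [/\ unique_nbhds G' 3,
        (1 - epsilon) * (powR (ln n%:R) (2 + delta) / n%:R) * 'C(n, 2)%:R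
          <= (edge_hamming G1 G')%:R
      & (edge_hamming G1 G')%:R
          <= (1 + epsilon) * (powR (ln n%:R) (2 + delta) / n%:R) * 'C(n, 2)%:R].
Proof.
set s := 2 + delta; set c : R := (ln 2)^-1.
have s0 : 0 < s by rewrite /s; lra.
have c0 : 0 <= c by rewrite invr_ge0 ln_ge0 // ler1n.
(* The three thresholds on [ln n] serve [4 * (b + 3) <= L], [L <= n / 32] and [n ^ lambda <= n / 4],
   in this order. *)
pose X0 := Num.max (4 * c + 16) (Num.max (2 * (s * ln (2 * s) + ln 32)) (ln 4 / (1 - lambda))).
exists (maxn 16 (maxn (Num.truncn (expR X0)).+1 (Num.truncn epsilon^-1).+1)) => n.
rewrite !geq_max => /and3P[n16 n_X0 n_eps] G1 small.
have n1 : (1 < n)%N by apply: leq_trans n16.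
have n0 : 0 < n%:R :> R by rewrite ltr0n ltnW.
have nr16 : 16 <= n%:R :> R by rewrite ler_nat.
have ltn_trunc (y : R) : (Num.truncn y < n)%N -> y <= n%:R.
  move=> lt_n; apply: le_trans (ltW (truncnS_gt y)) _; by rewrite ler_nat.
set x := ln n%:R.
have nE : n%:R = expR x by rewrite /x lnK.
have : X0 <= x by rewrite -ler_expR -nE ltn_trunc.
rewrite !ge_max => /and3P[x_c x_s]; rewrite ler_pdivrMr ?subr_gt0 // => x_lambda.
have eps_n : 1 <= epsilon * n%:R by rewrite -ler_pdivrMl // mulr1 ltn_trunc.
set L := powR x s.
have x0 : 0 < x by lra.
have L_lb : x * x <= L.
  rewrite -expr2 -powR_mulrn ?(ltW x0) //; apply: ler_powR; rewrite ?/s; lra.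
have L_ub : L <= n%:R / 32 by rewrite nE powR_le_expR_div.
have lambda_n : powR n%:R lambda <= n%:R / 4 by apply: powR_le_div => //; rewrite -/x; lra.
pose Y := L / n%:R * 'C(n, 2)%:R.
have YE : Y = L * (n%:R - 1) / 2.
  apply: (mulfI (_ : 2 != 0)); rewrite ?pnatr_eq0 // /Y mulrCA natr_bin2.
  by field; rewrite gt_eqF.
have [b n2b b_le] : exists2 b, (n <= 2 ^ b)%N & b%:R <= c * x + 1.
  exists (up_log 2 n); last exact: up_log2_le_ln.
  by have /andP[] := up_log_bounds (isT : 1 < 2)%N n1.
have Y_lb : (b%:R + 3) * n%:R <= Y.
  have h1 : 4 * (b%:R + 3) <= L by nra.
  have h2 : n%:R / 2 <= n%:R - 1 :> R by lra.
  rewrite YE; nra.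
have Y_ub : Y <= n%:R * n%:R / 64.
  have : L * (n%:R - 1) <= n%:R / 32 * n%:R by apply: ler_pM; rewrite ?powR_ge0 //; lra.
  by rewrite YE; lra.
(* Compare the two bounds on [Y]. *)
have b_ub : (64 * (b + 3) <= n)%N.
  rewrite -(ler_nat R) natrM natrD -(ler_pM2r n0); lra.
have Y0 : 0 <= Y by apply: le_trans Y_lb; rewrite mulr_ge0 ?addr_ge0 ?ler0n.
have [T_le T_gt] := andP (truncn_itv Y0); set T := Num.truncn Y in T_le T_gt.
have [] := @unique_nbhds_of_perturbation n b (n %/ 4) T G1.
- by clear - b_ub n16; lia.
- exact: n2b.
- by rewrite truncn_ge_nat // natrM natrD.
(* Even rounded down, [n %/ 4] is at least [n / 8], whose square bounds [Y]. *)
- have a8 : (n <= 8 * (n %/ 4))%N by clear - n16; lia.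
  have : n%:R <= 8 * (n %/ 4)%:R :> R by rewrite -natrM ler_nat.
  by rewrite -(ler_nat R) natrM; nra.
(* Neighbors of [v] lie in its 2-ball, of size at most [n ^ lambda <= n / 4]. *)
- move=> v; suff : (4 * #|[set w | G1 v w]| <= n)%N by clear - b_ub; lia.
  rewrite -(ler_nat R) natrM -ler_pdivlMl //.
  rewrite mulrC (le_trans _ lambda_n) // (le_trans _ (small v)) // ler_nat.
  rewrite card_sig; apply/subset_leq_card/subsetP => w; rewrite inE => vw.
  by apply/gballP; exists [:: w]; rewrite /= vw.
move=> G' uniqG' dist_T; exists G'; rewrite dist_T.
have YM t : t * (L / n%:R) * 'C(n, 2)%:R = t * Y by rewrite -mulrA.
rewrite !YM.
have Y_n : n%:R <= Y by apply: le_trans Y_lb; rewrite ler_peMl ?ler_wpDl ?ler0n ?ler1n.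
(* Rounding [Y] down to [T] loses less than 1, which fits in the tolerance. *)
have eps_Y : 1 <= epsilon * Y by apply: le_trans eps_n _; rewrite ler_pM2l.
move: T_gt; rewrite -natr1 => T_gt.
by split; [| lra | lra].
Qed.
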